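(* For each integer $n\ge 1$ let $P_n$ be the finite presentation \[ P_{n}=\Big\langle\, x_{\eta}\ \big(\eta \in \textstyle\bigcup_{i=0}^{n-1} \{0,1\}^{i}\big)\ \Big|\ x_{\eta}^{3}=e\ \ \forall \eta \in \{0,1\}^{n-1},\quad x_{\eta 0}x_{\eta 1}=x_{\eta}^{3}\ \ \forall \eta \in \textstyle\bigcup_{i=0}^{n-2} \{0,1\}^{i}\,\Big\rangle , \] and let $P_0=\langle\ \mid\ \rangle$ be the empty presentation of the trivial group. Write $\overline{P}_n$ for the group presented by $P_n$. Then for every $n\ge 1$: (1) $\overline{P}_{n}/\mathrm{Tor}_{1}(\overline{P}_{n}) \cong \overline{P}_{n-1}$; (2) $\mathrm{TorLen}(\overline{P}_{n})=n$. Moreover $P_n$ has $2^n-1$ generators and $2^n-1$ relators.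
   Context: $\{0,1\}^i$ denotes the set of binary strings of length exactly $i$, with $\{0,1\}^0=\{\emptyset\}$ (the empty string); for a string $\eta$, $\eta0$ and $\eta1$ denote the strings obtained by appending $0$ or $1$ on the right. For a group $G$, $\mathrm{Tor}(G)$ is the set of elements of finite order. Define $\mathrm{Tor}_0(G)=\{e\}$ and inductively $\mathrm{Tor}_{i+1}(G)$ to be the normal closure in $G$ of $\{g\in G : g\,\mathrm{Tor}_i(G)\text{ has finite order in } G/\mathrm{Tor}_i(G)\}$; set $\mathrm{Tor}_\infty(G)=\bigcup_{i\in\mathbb{N}}\mathrm{Tor}_i(G)$. The torsion length $\mathrm{TorLen}(G)$ is the smallest $n\ge 0$ with $\mathrm{Tor}_n(G)=\mathrm{Tor}_\infty(G)$ (equivalently $\mathrm{Tor}_n(G)=\mathrm{Tor}_{n+1}(G)$), and $\mathrm{TorLen}(G)=\infty$ if no such $n$ exists. *)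

(* Defs.v *)
From mathcomp Require Import all_boot.
Set Implicit Arguments. Unset Strict Implicit. Unset Printing Implicit Defensive.

Record Grp := {
  carrier :> Type;
  gmul : carrier -> carrier -> carrier;
  ginv : carrier -> carrier;
  gone : carrier;
  gmulA : forall a b c, gmul a (gmul b c) = gmul (gmul a b) c;
  gmul1 : forall a, gmul gone a = a;
  gmulV : forall a, gmul (ginv a) a = gone
}.
Arguments gmul {g}. Arguments ginv {g}. Arguments gone {g}.

Fixpoint gpow (G : Grp) (g : G) (k : nat) : G :=
  if k is k'.+1 then gmul g (gpow g k') else gone.

Definition is_hom (G H : Grp) (f : G -> H) : Prop :=
  forall a b : G, f (gmul a b) = gmul (f a) (f b).

Definition normal_subgroup (G : Grp) (N : G -> Prop) : Prop :=
  [/\ N gone,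
      (forall a b, N a -> N b -> N (gmul a b)),
      (forall a, N a -> N (ginv a)) &
      (forall a g, N a -> N (gmul (ginv g) (gmul a g)))].

Definition ncl (G : Grp) (S : G -> Prop) : G -> Prop :=
  fun g => forall N : G -> Prop, normal_subgroup N -> (forall s, S s -> N s) -> N g.

(* Tor_0 = {e};  Tor_{i+1} = normal closure of the g whose coset mod Tor_i has
   finite order, i.e. g^k \in Tor_i for some k >= 1 (Tor_i being normal). *)
Fixpoint Tor (G : Grp) (i : nat) : G -> Prop :=
  match i with
  | 0 => fun g => g = gone
  | i'.+1 => ncl (fun g : G => exists k, 0 < k /\ Tor i' (gpow g k))
  end.

Definition Tor_inf (G : Grp) : G -> Prop := fun g => exists i, Tor i g.

Definition TorLen_is (G : Grp) (m : nat) : Prop :=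
  (forall g : G, Tor m g <-> Tor_inf g) /\
  (forall k, k < m -> ~ (forall g : G, Tor k g <-> Tor_inf g)).

(* generators are binary strings; a relator is a word of letters (gen, inverted?) *)
Record presentation := {
  pgens : seq (seq bool);
  prels : seq (seq (seq bool * bool))
}.

Definition eval_letter (G : Grp) (x : seq bool -> G) (l : seq bool * bool) : G :=
  if l.2 then ginv (x l.1) else x l.1.

Definition eval_word (G : Grp) (x : seq bool -> G) (w : seq (seq bool * bool)) : G :=
  foldr (fun l acc => gmul (eval_letter x l) acc) gone w.

Definition satisfies (P : presentation) (G : Grp) (x : seq bool -> G) : Prop :=
  forall r, r \in prels P -> eval_word x r = gone.

Definition presents (P : presentation) (G : Grp) (x : seq bool -> G) : Prop :=
  satisfies P x /\
  forall (H : Grp) (y : seq bool -> H), satisfies P y ->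
    (exists f : G -> H, is_hom f /\ forall s, s \in pgens P -> f (x s) = y s) /\
    (forall f f' : G -> H, is_hom f -> is_hom f' ->
       (forall s, s \in pgens P -> f (x s) = y s) ->
       (forall s, s \in pgens P -> f' (x s) = y s) ->
       forall g, f g = f' g).

(* binary strings of length exactly i; eta0 = rcons eta false, eta1 = rcons eta true *)
Fixpoint strings (i : nat) : seq (seq bool) :=
  if i is i'.+1 then flatten [seq [:: rcons s false; rcons s true] | s <- strings i']
  else [:: [::]].

Definition strings_lt (n : nat) : seq (seq bool) :=
  flatten [seq strings i | i <- iota 0 n].

Definition gen (s : seq bool) : seq bool * bool := (s, false).
Definition igen (s : seq bool) : seq bool * bool := (s, true).

Definition rel_cube (eta : seq bool) := [:: gen eta; gen eta; gen eta].
Definition rel_split (eta : seq bool) :=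
  [:: gen (rcons eta false); gen (rcons eta true); igen eta; igen eta; igen eta].

Definition Pres (n : nat) : presentation :=
  match n with
  | 0 => {| pgens := [::]; prels := [::] |}
  | n'.+1 => {| pgens := strings_lt n;
                prels := [seq rel_cube eta | eta <- strings n'] ++
                         [seq rel_split eta | eta <- strings_lt n'] |}
  end.

(* Main.v *)
(** Writing [G_n] for the group presented by [P_n], the group [G_(n+1)] arises from
    the free product [F] of two copies of [G_n], with roots [x_0] and [x_1], by
    adjoining a cube root [x] of [x_0 x_1].  Both roots are nontrivial, as one sees
    by mapping the root to a generator of [Z/3] and all other generators to [0];
    hence [x_0 x_1] has infinite order and [G_(n+1)] is the amalgam of [F] with the
    infinite cyclic group [<x>].  A torsion element of an amalgam is conjugate into
    a factor, so by induction every torsion element of [G_(n+1)] is conjugate to a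
    torsion element of [G_1], that is, to a power of a leaf generator.
    Thus [Tor_1] is the normal closure of the leaves, and killing the leaves of
    [P_(n+1)] gives [P_n].  Consequently [Tor_(i+1)] of [G_(n+1)] is the preimage of
    [Tor_i] of [G_n], and the root, which survives in [G_1 = Z/3], shows that no
    earlier term of the series is everything. *)

Require Import Defs.
From mathcomp Require Import all_boot.
From mathcomp Require Import ssralg ssrint zmodp boolp.

Set Implicit Arguments. Unset Strict Implicit. Unset Printing Implicit Defensive.

Local Notation "a ** b" := (gmul a b) (at level 40, left associativity).

(** * Elementary group theory *)

Section GroupLaws.
Variable G : Grp.
Implicit Types a b c g h : G.

Lemma gmulKl a b : ginv a ** (a ** b) = b.
Proof. by rewrite gmulA gmulV gmul1. Qed.

Lemma gmul_injl a b c : a ** b = a ** c -> b = c.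
Proof. by move=> /(congr1 (gmul (ginv a))); rewrite !gmulKl. Qed.

Lemma gmulg1 a : a ** gone = a.
Proof. by apply: (@gmul_injl (ginv a)); rewrite gmulA gmulV gmul1. Qed.

Lemma gmulgV a : a ** ginv a = gone.
Proof. by apply: (@gmul_injl (ginv a)); rewrite gmulA gmulV gmul1 gmulg1. Qed.

Lemma gmulVKl a b : a ** (ginv a ** b) = b.
Proof. by rewrite gmulA gmulgV gmul1. Qed.

Lemma gmul_injr a b c : b ** a = c ** a -> b = c.
Proof.
by move=> /(congr1 (gmul^~ (ginv a))); rewrite -!gmulA gmulgV !gmulg1.
Qed.

Lemma ginv_eq a b : a ** b = gone -> ginv a = b.
Proof. by move=> ab; apply: (@gmul_injl a); rewrite ab gmulgV. Qed.

Lemma ginvK a : ginv (ginv a) = a.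
Proof. exact/ginv_eq/gmulV. Qed.

Lemma ginv1 : ginv gone = gone :> G.
Proof. by apply: ginv_eq; rewrite gmul1. Qed.

Lemma ginvM a b : ginv (a ** b) = ginv b ** ginv a.
Proof. by apply: ginv_eq; rewrite -gmulA gmulVKl gmulgV. Qed.

Lemma gmulV_eq1 a b : a ** ginv b = gone -> a = b.
Proof. by move=> ab; apply: (@gmul_injr (ginv b)); rewrite ab gmulgV. Qed.

Definition gconj a g := ginv g ** (a ** g).

Lemma gconjM a b g : gconj (a ** b) g = gconj a g ** gconj b g.
Proof. by rewrite /gconj -!gmulA gmulVKl. Qed.

Lemma gconj1 g : gconj gone g = gone.
Proof. by rewrite /gconj gmul1 gmulV. Qed.

Lemma gconjJ a g h : gconj (gconj a g) h = gconj a (g ** h).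
Proof. by rewrite /gconj ginvM -!gmulA. Qed.

Lemma gconjg1 a : gconj a gone = a.
Proof. by rewrite /gconj ginv1 gmul1 gmulg1. Qed.

Lemma gconj_pow a g k : gpow (gconj a g) k = gconj (gpow a k) g.
Proof.
by elim: k => [|k IH]; [rewrite /= gconj1 | rewrite [LHS]/= IH -gconjM].
Qed.

Lemma gpow1n k : gpow gone k = gone :> G.
Proof. by elim: k => //= k ->; rewrite gmul1. Qed.

Lemma gpowSr a k : gpow a k.+1 = gpow a k ** a.
Proof.
elim: k => [|k IH]; first by rewrite /= gmulg1 gmul1.
by rewrite -[LHS]/(a ** gpow a k.+1) {1}IH gmulA.
Qed.

End GroupLaws.

(** * Homomorphisms, normal closures, quotients and subgroups *)

Section Homs.
Variables (G H : Grp) (f : G -> H).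
Hypothesis fM : is_hom f.

Lemma hom1 : f gone = gone.
Proof. by apply: (@gmul_injl _ (f gone)); rewrite -fM gmul1 gmulg1. Qed.

Lemma homV a : f (ginv a) = ginv (f a).
Proof. by apply/esym/ginv_eq; rewrite -fM gmulgV hom1. Qed.

Lemma hom_pow a k : f (gpow a k) = gpow (f a) k.
Proof. by elim: k => [|k IH] /=; rewrite ?hom1 // fM IH. Qed.

Lemma hom_conj a g : f (gconj a g) = gconj (f a) (f g).
Proof. by rewrite !fM homV. Qed.

Lemma hom_inj : (forall a, f a = gone -> a = gone) -> injective f.
Proof.
move=> ker1 a b fab; apply/gmulV_eq1/ker1.
by rewrite fM homV fab gmulgV.
Qed.

Lemma hom_eval_word (x : seq bool -> G) w :
  f (eval_word x w) = eval_word (f \o x) w.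
Proof.
elim: w => [|[s b] w IH] /=; first exact: hom1.
by rewrite fM IH /eval_letter; case: b; rewrite //= homV.
Qed.

Lemma normal_preim (N : H -> Prop) :
  normal_subgroup N -> normal_subgroup (fun g => N (f g)).
Proof.
case=> N1 NM NV NJ; split=> [|a b Na Nb|a Na|a g Na].
- by rewrite hom1.
- by rewrite fM; apply: NM.
- by rewrite homV; apply: NV.
- by rewrite !fM homV; apply: NJ.
Qed.

Lemma ncl_hom (S : G -> Prop) (T : H -> Prop) :
  (forall s, S s -> T (f s)) -> forall g, ncl S g -> ncl T (f g).
Proof.
by move=> ST g Sg N nN TN; apply: (Sg _ (normal_preim nN)) => s /ST/TN.
Qed.

(** The image of a normal subgroup under a surjection is normal, so [f g = f g'] for some [g'] in
    [N]; the two differ by a kernel element, which lies in the preimage of [T] because of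
    [T gone]. *)
Lemma ncl_preim (T : H -> Prop) : (forall h, exists g, f g = h) -> T gone ->
  forall g, ncl T (f g) -> ncl (fun g => T (f g)) g.
Proof.
move=> surj T1 g Tg N nN TN.
have [N1 NM NV NJ] := nN.
have [||g' Ng' fgg'] := Tg (fun h => exists2 g', N g' & f g' = h).
- split=> [|_ _ [a Na <-] [b Nb <-]|_ [a Na <-]|_ h [a Na <-]].
  + by exists gone => //; apply: hom1.
  + by exists (a ** b) => //; apply: NM.
  + by exists (ginv a); [apply: NV | apply: homV].
  + have [b <-] := surj h.
    by exists (gconj a b); [apply: NJ | apply: hom_conj].
- by move=> h Th; have [a fa] := surj h; exists a => //; apply: TN; rewrite fa.
- rewrite -(gmulg1 g) -(gmulV g') gmulA; apply: NM => //; apply: TN.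
  by rewrite fM homV fgg' gmulgV.
Qed.

End Homs.

Lemma normal_one (G : Grp) : normal_subgroup (fun g : G => g = gone).
Proof.
by split=> [|_ _ -> ->|_ ->|_ g ->]; rewrite ?gmul1 ?ginv1 ?gmulV.
Qed.

Lemma normal_ncl (G : Grp) (S : G -> Prop) : normal_subgroup (ncl S).
Proof.
split=> [|a b Sa Sb|a Sa|a g Sa] N nN SN; have [N1 NM NV NJ] := nN => //.
- by apply: NM; [apply: Sa | apply: Sb].
- by apply: NV; apply: Sa.
- by apply: NJ; apply: Sa.
Qed.

Lemma sub_ncl (G : Grp) (S : G -> Prop) g : S g -> ncl S g.
Proof. by move=> Sg N _; apply. Qed.

Lemma ncl_min (G : Grp) (S T : G -> Prop) :
  (forall g, S g -> ncl T g) -> forall g, ncl S g -> ncl T g.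
Proof. by move=> ST g; apply=> //; apply: normal_ncl. Qed.

(** The elements are the classes [R a] seen as predicates, equal by extensionality when related; the
    operations use chosen representatives. *)
Lemma quotient_grp (T : Type) (mul : T -> T -> T) (inv : T -> T) (one : T)
    (R : T -> T -> Prop) :
  (forall a, R a a) -> (forall a b, R a b -> R b a) ->
  (forall b a c, R a b -> R b c -> R a c) ->
  (forall a a' b b', R a a' -> R b b' -> R (mul a b) (mul a' b')) ->
  (forall a a', R a a' -> R (inv a) (inv a')) ->
  (forall a b c, R (mul a (mul b c)) (mul (mul a b) c)) ->
  (forall a, R (mul one a) a) -> (forall a, R (mul (inv a) a) one) ->
  exists (Q : Grp) (pi : T -> Q),
    [/\ forall a b, pi (mul a b) = pi a ** pi b,
        forall q, exists a, pi a = q & forall a b, pi a = pi b <-> R a b].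
Proof.
move=> Rr Rs Rt RM RV RA R1 RVl.
pose Q := {P : T -> Prop | exists a, P = R a}.
pose pi a : Q := exist _ (R a) (ex_intro _ a erefl).
have piP a b : pi a = pi b <-> R a b.
  split=> [[->] // | ab]; apply: eq_exist; apply/predeqP => c.
  by split; apply: Rt => //; apply: Rs.
have piS (q : Q) : exists a, pi a = q.
  by case: q => P [a Pa]; exists a; apply: eq_exist.
have [rep repK] := choice piS.
have Rrep a : R (rep (pi a)) a by apply/piP.
pose mulQ q q' := pi (mul (rep q) (rep q')).
have mulE a b : mulQ (pi a) (pi b) = pi (mul a b) by apply/piP/RM.
have invE a : pi (inv (rep (pi a))) = pi (inv a) by apply/piP/RV.
have QA (p q r : Q) : mulQ p (mulQ q r) = mulQ (mulQ p q) r.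
  by rewrite -(repK p) -(repK q) -(repK r) !mulE; apply/piP.
have Q1 (p : Q) : mulQ (pi one) p = p by rewrite -(repK p) !mulE; apply/piP.
have QV (p : Q) : mulQ (pi (inv (rep p))) p = pi one.
  by rewrite -(repK p) invE mulE; apply/piP.
by exists (Build_Grp QA Q1 QV), pi; split=> // a b; rewrite -mulE.
Qed.

Lemma quotient_normal (G : Grp) (N : G -> Prop) : normal_subgroup N ->
  exists (Q : Grp) (pi : G -> Q),
    [/\ is_hom pi, forall q, exists a, pi a = q & forall a, pi a = gone <-> N a].
Proof.
case=> N1 NM NV NJ; pose R (a b : G) := N (ginv a ** b).
have NC a b : N (a ** b) -> N (b ** a).
  by move=> /(NJ _ a); rewrite -!gmulA gmulKl.
have [| | | | | | | |Q [pi [piM piS piP]]] :=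
  @quotient_grp G gmul ginv gone R; rewrite /R.
- by move=> a; rewrite gmulV.
- by move=> a b /NV; rewrite ginvM ginvK.
- by move=> b a c ab bc; have:= NM _ _ ab bc; rewrite -gmulA gmulVKl.
- move=> a a' b b' aa' bb'; rewrite ginvM -gmulA (gmulA _ a' b').
  by apply/(NC _ _); rewrite -gmulA; apply: NM => //; apply: NC.
- by move=> a a' /NV; rewrite ginvM !ginvK => /NC.
- by move=> a b c; rewrite -(gmulA a) gmulV.
- by move=> a; rewrite gmul1 gmulV.
- by move=> a; rewrite !gmulV.
- have pi1 : pi gone = gone by exact: hom1.
  exists Q, pi; split=> // a; rewrite -pi1; split => [/esym/piP|Na].
    by rewrite /R ginv1 gmul1.
  by apply/esym/piP; rewrite /R ginv1 gmul1.
Qed.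

Definition is_subgroup (G : Grp) (S : G -> Prop) :=
  [/\ S gone, forall a b, S a -> S b -> S (a ** b) & forall a, S a -> S (ginv a)].

Lemma subgroup_grp (G : Grp) (S : G -> Prop) : is_subgroup S ->
  exists (K : Grp) (v : K -> G),
    [/\ is_hom v, injective v, forall k, S (v k)
      & forall g, S g -> exists k, v k = g].
Proof.
case=> S1 SM SV; pose K := {g | S g}.
pose mul (a b : K) : K := exist S (sval a ** sval b) (SM _ _ (svalP a) (svalP b)).
pose inv (a : K) : K := exist S (ginv (sval a)) (SV _ (svalP a)).
pose one : K := exist S gone S1.
have KA a b c : mul a (mul b c) = mul (mul a b) c by apply/eq_exist/gmulA.
have K1 a : mul one a = a by case: a => a Sa; apply/eq_exist/gmul1.
have KV a : mul (inv a) a = one by apply/eq_exist/gmulV.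
exists (Build_Grp KA K1 KV), sval; split=> // [[a ?] [b ?] /= ?|k|g Sg].
- exact: eq_exist.
- exact: svalP.
- by exists (exist S g Sg).
Qed.

(** * Symmetric groups and actions *)

Section SymmetricGroup.
Variable T : Type.

Definition bij_pair := {p : (T -> T) * (T -> T) | cancel p.1 p.2 /\ cancel p.2 p.1}.

Lemma bij_pair_eq (p q : bij_pair) : (sval p).1 =1 (sval q).1 -> p = q.
Proof.
case: p q => -[f f'] [/= fK f'K] [[g g'] [/= gK g'K]] fg.
apply: eq_exist; congr pair; apply/funext => // t.
by rewrite -{1}(g'K t) -fg fK.
Qed.

Definition bij_mul (p q : bij_pair) : bij_pair.
Proof.
exists ((sval p).1 \o (sval q).1, (sval q).2 \o (sval p).2).
case: p q => p [pK Kp] [q [qK Kq]]; split; exact: can_comp.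
Defined.

Definition bij_inv (p : bij_pair) : bij_pair.
Proof. by exists ((sval p).2, (sval p).1); case: p => p []. Defined.

Definition bij_one : bij_pair.
Proof. by exists (id, id). Defined.

Definition Sym : Grp.
Proof.
apply: (@Build_Grp bij_pair bij_mul bij_inv bij_one).
- by move=> p q r; apply: bij_pair_eq.
- by move=> p; apply: bij_pair_eq.
- by move=> p; apply: bij_pair_eq => t; case: p => p [pK _] /=.
Defined.

Definition sapply (p : Sym) (t : T) : T := (sval p).1 t.

Lemma sapplyM (p q : Sym) t : sapply (p ** q) t = sapply p (sapply q t).
Proof. by []. Qed.

Lemma sapply1 t : sapply gone t = t.
Proof. by []. Qed.

Lemma Sym_eq (p q : Sym) : sapply p =1 sapply q -> p = q.
Proof. exact: bij_pair_eq. Qed.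

Lemma action_hom (G : Grp) (act : G -> T -> T) :
  act gone =1 id -> (forall a b t, act (a ** b) t = act a (act b t)) ->
  exists theta : G -> Sym, is_hom theta /\ forall g, sapply (theta g) =1 act g.
Proof.
move=> act1 actM.
have actK g : cancel (act g) (act (ginv g)) /\ cancel (act (ginv g)) (act g).
  by split=> t; rewrite -actM ?gmulV ?gmulgV act1.
exists (fun g => exist _ (act g, act (ginv g)) (actK g)); split=> // a b.
exact/Sym_eq/actM.
Qed.

End SymmetricGroup.

(** * Amalgamated products *)

(** The relation fails at some adjacent pair, possibly the wrap-around one, and a rotation brings it
    to the front. For words in a group, rotation is conjugation. *)
Lemma not_cycle_split (T : Type) (e : rel T) u v l : ~~ cycle e [:: u, v & l] ->
  exists p q a b r,
    [/\ p ++ q = [:: u, v & l], q ++ p = [:: a, b & r] & ~~ e a b].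
Proof.
have main m p y : p ++ y :: m = [:: u, v & l] -> ~~ path e y (rcons m u) ->
  exists p q a b r,
    [/\ p ++ q = [:: u, v & l], q ++ p = [:: a, b & r] & ~~ e a b].
  elim: m p y => [|z m IH] p y E /=.
    rewrite andbT => yu; case: p E => [//|u' p] E.
    by exists (u' :: p), [:: y], y, u, p; split=> //; case: E => ->.
  rewrite negb_and => /orP[yz|]; last by apply: (IH (rcons p y)); rewrite cat_rcons.
  by exists p, [:: y, z & m], y, z, (m ++ p).
by move=> /= nc; apply: (main (v :: l) [::] u).
Qed.

Section Amalgam.
Variables (C : Grp) (A : bool -> Grp) (i : forall s, C -> A s).
Hypothesis iM : forall s, is_hom (@i s).
Hypothesis iI : forall s, injective (@i s).

Definition in_base s (g : A s) := exists c, g = i s c.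

Lemma transversal s : exists rep : A s -> A s,
  [/\ forall g, exists c, g = i s c ** rep g,
      forall c g, rep (i s c ** g) = rep g & rep gone = gone].
Proof.
pose R (g h : A s) := exists c, h = i s c ** g.
have Rr g : R g g by exists gone; rewrite hom1 // gmul1.
have Rs g h : R g h -> R h g.
  by case=> c ->; exists (ginv c); rewrite homV // gmulKl.
have Rt g h k : R g h -> R h k -> R g k.
  by case=> c -> [d ->]; exists (d ** c); rewrite iM gmulA.
(* Choosing on predicates makes the representative depend only on the coset; the last clause pins
   that of the base to [gone]. *)
pose P (X : A s -> Prop) (h : A s) :=
  (exists g, X = R g) -> X h /\ (X gone -> h = gone).
have exP X : exists h, P X h.
  have [X1|nX1] := pselect (X gone); first by exists gone.
  have [[g Xg]|nX] := pselect (exists g, X = R g); last by exists gone => /nX.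
  by exists g => _; split=> //; rewrite Xg.
have [r rP] := choice exP.
have RP g : R g (r (R g)) /\ (R g gone -> r (R g) = gone) by apply: rP; exists g.
exists (fun g => r (R g)); split=> [g|c g|].
- by have [/Rs[c]] := RP g; exists c.
- congr r; apply/predeqP => h; split; apply: Rt; first by exists c.
  by apply: Rs; exists c.
- by have [_] := RP gone; apply.
Qed.

Definition rep s : A s -> A s := sval (cid (transversal s)).

Lemma repE s (g : A s) : exists c, g = i s c ** rep g.
Proof. by rewrite /rep; case: cid => r []. Qed.

Lemma rep_base s c (g : A s) : rep (i s c ** g) = rep g.
Proof. by rewrite /rep; case: cid => r []. Qed.

Lemma rep1 s : rep gone = gone :> A s.
Proof. by rewrite /rep; case: cid => r []. Qed.

Definition cof s (g : A s) : C := sval (cid (repE g)).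

Lemma cofE s (g : A s) : g = i s (cof g) ** rep g.
Proof. exact: svalP (cid (repE g)). Qed.

Lemma rep_id s (g : A s) : rep (rep g) = rep g.
Proof. by rewrite {2}(cofE g) rep_base. Qed.

Lemma cof_base s c (g : A s) : cof (i s c ** g) = c ** cof g.
Proof.
apply: (@iI s); apply: (@gmul_injr _ (rep g)).
by rewrite iM -gmulA -cofE -{1}(rep_base c g) -cofE.
Qed.

Lemma rep_in_base s (g : A s) : rep g = gone <-> in_base g.
Proof.
split=> [g1|[c ->]]; first by exists (cof g); rewrite {1}(cofE g) g1 gmulg1.
by rewrite -(gmulg1 (i s c)) rep_base rep1.
Qed.

Lemma cof_rep s (g : A s) : rep g = g -> cof g = gone.
Proof.
move=> gg; apply: (@iI s); apply: (@gmul_injr _ g).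
by rewrite -{2}gg -cofE hom1 // gmul1.
Qed.

Definition letter := {s : bool & A s}.

Lemma existT_bool_inj s (g h : A s) :
  existT (fun s => A s : Type) s g = existT _ s h -> g = h.
Proof.
by move=> E; have:= projT2_eq E; rewrite (eq_irrelevance (projT1_eq E) erefl).
Qed.

(* Alternating lists of nontrivial coset representatives whose first letter does
   not come from the factor [b]; with [b = None] there is no condition on it. *)
Fixpoint nf (b : option bool) (l : seq letter) : Prop :=
  if l is u :: l' then
    [/\ b <> Some (tag u), rep (tagged u) = tagged u, tagged u <> gone
      & nf (Some (tag u)) l']
  else True.

Lemma nf_None b l : nf b l -> nf None l.
Proof. by case: l => //= u l []. Qed.

(* The van der Waerden set of normal forms [c t1 ... tm]. *)
Definition nform := {p : C * seq letter | nf None p.2}.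
(** Normal forms seen from the factor [s]: any element of [A s], then a tail not starting in [s].
    [join] identifies this set with [nform], and left multiplication on the first component gives
    the action of [A s]. *)
Definition nform_split s := {p : A s * seq letter | nf (Some s) p.2}.

Definition push s (g : A s) (l : seq letter) : C * seq letter :=
  (cof g, if pselect (rep g = gone) then l
          else existT (fun s => A s : Type) s (rep g) :: l).

Lemma push_nf s (g : A s) l : nf (Some s) l -> nf None (push g l).2.
Proof.
rewrite /push /=; case: pselect => //= [_|g1] nfl; first exact: nf_None nfl.
by split=> //; apply: rep_id.
Qed.

Definition join s (p : nform_split s) : nform :=
  exist _ (push (sval p).1 (sval p).2) (push_nf _ (svalP p)).

(** The tail never starts in [s], so the head of the list tells whether a representative was
    prepended. *)
Lemma join_inj s : injective (@join s).
Proof.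
move=> [[g l] /= nfl] [[h m] /= nfm] /(congr1 sval); rewrite /= /push.
case=> cgh E; apply: eq_exist; suff [-> rgh]: l = m /\ rep g = rep h.
  by rewrite (cofE g) (cofE h) cgh rgh.
move: E; case: pselect => [g1|g1]; case: pselect => [h1|h1] /=.
- by rewrite g1 h1.
- by move=> lE; move: nfl; rewrite lE /= => -[].
- by move=> lE; move: nfm; rewrite -lE /= => -[].
- move=> E; have [_ ->] := E; split=> //; apply: existT_bool_inj.
  exact: (congr1 (head (existT (fun s => A s : Type) s (rep g))) E).
Qed.

Lemma join_surj s (w : nform) : exists p, @join s p = w.
Proof.
case: w => -[c l] /= nfl.
have [nfs|nnfs] := pselect (nf (Some s) l).
  exists (exist _ (i s c, l) nfs); apply: eq_exist; rewrite /push /=.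
  case: pselect => [r1|[]] /=; last by apply/rep_in_base; exists c.
  by rewrite -(gmulg1 (i s c)) cof_base cof_rep ?rep1 // gmulg1.
case: l nfl nnfs => [|[s' t] l] /= nfl nnfs; first by case: nnfs.
have [_ rt t1 nfl'] := nfl.
have ss' : s = s'.
  by apply: contrapT => ss'; apply: nnfs; split=> // -[].
case: _ / ss' t rt t1 nfl' nfl {nnfs} => t rt t1 nfl' nfl.
exists (exist _ (i s c ** t, l) nfl'); apply: eq_exist; rewrite /push /=.
rewrite rep_base rt cof_base cof_rep // gmulg1.
by case: pselect.
Qed.

Definition unjoin s (w : nform) : nform_split s := sval (cid (join_surj s w)).

Lemma unjoinK s : cancel (@unjoin s) (@join s).
Proof. by move=> w; rewrite /unjoin; case: cid. Qed.

Lemma joinK s : cancel (@join s) (@unjoin s).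
Proof. by move=> p; apply: join_inj; rewrite unjoinK. Qed.

Definition lmul s (g : A s) (p : nform_split s) : nform_split s :=
  exist _ (g ** (sval p).1, (sval p).2) (svalP p).

Definition nact s (g : A s) (w : nform) : nform := join (lmul g (unjoin s w)).

Lemma nact1 s : nact (gone : A s) =1 id.
Proof.
move=> w; rewrite /nact -[RHS](unjoinK s); congr join.
by case: (unjoin s w) => -[g l] nfl; apply: eq_exist; rewrite /= gmul1.
Qed.

Lemma nactM s (g h : A s) w : nact (g ** h) w = nact g (nact h w).
Proof.
rewrite /nact joinK; congr join.
by apply: eq_exist; rewrite /= gmulA.
Qed.

(** The result does not depend on [s]: the two factors act alike through [C], as needed to make the
    amalgam act. *)
Lemma nact_base s c w :
  sval (nact (i s c) w) = (c ** (sval w).1, (sval w).2).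
Proof.
rewrite -{2 3}(unjoinK s w) /= /push /= cof_base rep_base //.
Qed.

Lemma nact_split s (g : A s) w : nf (Some s) (sval w).2 ->
  sval (nact g w) = push (g ** i s (sval w).1) (sval w).2.
Proof.
case: w => -[c l] nfl0 /= nfl.
suff -> : exist _ (c, l) nfl0 = join (exist _ (i s c, l) nfl : nform_split s).
  by rewrite /nact joinK.
apply: eq_exist; rewrite /push /=.
case: pselect => [r1|[]] /=; last by apply/rep_in_base; exists c.
by rewrite -(gmulg1 (i s c)) cof_base cof_rep ?rep1 // gmulg1.
Qed.

Definition starts (s : bool) (w : nform) : Prop :=
  if (sval w).2 is u :: _ then tag u = s else False.

Lemma starts_nf s w : starts (~~ s) w -> nf (Some s) (sval w).2.
Proof.
case: w => -[c [|u l]] //= nfl; rewrite /starts /= => us.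
have [_ ru u1 nfl'] := nfl; by split=> //; rewrite us => -[]; case: (s).
Qed.

Lemma nact_starts s (g : A s) w :
  ~ in_base g -> nf (Some s) (sval w).2 -> starts s (nact g w).
Proof.
move=> gC nfw; rewrite /starts nact_split // /push /=.
case: pselect => // r1; have [c E] := (rep_in_base _).1 r1; case: gC.
exists (c ** ginv (sval w).1); rewrite iM homV // -E.
by rewrite -gmulA gmulgV gmulg1.
Qed.

(** * The amalgam and its action on normal forms *)

Variables (G : Grp) (al : forall s, A s -> G).
Hypothesis alM : forall s, is_hom (@al s).
Hypothesis al_base : forall c, al (i false c) = al (i true c).
Hypothesis al_gen : forall S : G -> Prop,
  is_subgroup S -> (forall s (g : A s), S (al g)) -> forall g, S g.
Hypothesis al_univ : forall (K : Grp) (be : forall s, A s -> K),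
  (forall s, is_hom (@be s)) -> (forall c, be false (i false c) = be true (i true c)) ->
  exists f : G -> K, is_hom f /\ forall s g, f (al g) = be s g.

Lemma al1 s : al (gone : A s) = gone.
Proof. exact: hom1 (@alM s). Qed.

Lemma nact_hom : exists f : G -> Sym nform,
  is_hom f /\ forall s (g : A s), sapply (f (al g)) =1 nact g.
Proof.
have theta s : exists th : A s -> Sym nform,
    is_hom th /\ forall g, sapply (th g) =1 nact g.
  apply: action_hom; [exact: nact1 | exact: nactM].
pose th s := sval (cid (theta s)).
have thM s : is_hom (th s) by rewrite /th; case: cid => ? [].
have thE s g : sapply (th s g) =1 nact g by rewrite /th; case: cid => ? [].
have [||f [fM fE]] := al_univ (be := th) => //.
  move=> c; apply: Sym_eq => w; rewrite !thE.
  have: sval (nact (i false c) w) = sval (nact (i true c) w).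
    by rewrite !nact_base.
  by case: (nact _ w) (nact _ w) => p ? [q ?] /= pq; apply: eq_exist.
by exists f; split=> // s g w; rewrite fE thE.
Qed.

Definition nil_nform : nform := exist (fun p : C * seq letter => nf None p.2) (gone, [::]) I.

(** Acting on the empty normal form, [al g] yields the normal form of [g], from which [g] can be
    read off. *)
Lemma amalgam_inj s : injective (@al s).
Proof.
apply: hom_inj => // g ag1; have [f [fM fE]] := nact_hom.
have := fE s g nil_nform; rewrite ag1 hom1 // sapply1.
move/(congr1 sval); rewrite nact_split //= hom1 // gmulg1 /push.
case: pselect => //= rg [cg].
by rewrite (cofE g) rg gmulg1 -cg hom1.
Qed.

Definition aeval (w : seq letter) : G :=
  foldr (fun u acc => al (tagged u) ** acc) gone w.

Lemma aeval_cat v w : aeval (v ++ w) = aeval v ** aeval w.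
Proof. by elim: v => [|u v IH] /=; rewrite ?gmul1 // IH gmulA. Qed.

Lemma aeval_surj g : exists w, g = aeval w.
Proof.
apply: (@al_gen (fun g => exists w, g = aeval w)); last first.
  by move=> s h; exists [:: existT _ s h]; rewrite /= gmulg1.
split=> [|_ _ [v ->] [w ->]|_ [w ->]]; first by exists [::].
  by exists (v ++ w); rewrite aeval_cat.
elim: w => [|u w [v IH]] /=; first by exists [::]; rewrite ginv1.
exists (v ++ [:: existT _ (tag u) (ginv (tagged u))]).
by rewrite aeval_cat ginvM IH /= gmulg1 (homV (@alM _)).
Qed.

(** Only the left letter must avoid the base: around a cycle every letter is a left letter, so
    [cycle reduced_step] expresses cyclic reducedness. *)
Definition reduced_step : rel letter :=
  fun u v => (tag u != tag v) && `[< ~ in_base (tagged u) >].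

(* Ping-pong: a reduced word sends the normal forms that do not start in the
   factor of its last letter to normal forms that start in the factor of its
   first letter. *)
Lemma path_starts (f : G -> Sym nform) : is_hom f ->
  (forall s (g : A s), sapply (f (al g)) =1 nact g) ->
  forall p u w, path reduced_step u p -> ~ in_base (tagged (last u p)) ->
  nf (Some (tag (last u p))) (sval w).2 ->
  starts (tag u) (sapply (f (aeval (u :: p))) w).
Proof.
move=> fM fE; elim=> [|v p IH] u w /=.
  by move=> _ uC nfw; rewrite gmulg1 fE; apply: nact_starts.
case/andP=> /andP[uv /asboolP uC] pv lC nfw.
rewrite fM sapplyM fE; apply: nact_starts => //; apply: starts_nf.
have -> : ~~ tag u = tag v by move: uv; do 2!case: (tag _).
exact: IH.
Qed.

(** The first and last letters lie in different factors, so a normal form starting like the word can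
    be fed to it again. Hence every positive power moves the empty normal form to a nonempty one. *)
Lemma cycle_pow_neq1 u p k : cycle reduced_step (u :: p) -> 0 < k ->
  gpow (aeval (u :: p)) k <> gone.
Proof.
rewrite /= rcons_path => /andP[pu /andP[/= lu /asboolP lC]] k0 gk.
have [f [fM fE]] := nact_hom.
have step w : nf (Some (tag (last u p))) (sval w).2 ->
    starts (tag u) (sapply (f (aeval (u :: p))) w) by exact: path_starts.
have: starts (tag u) (sapply (f (gpow (aeval (u :: p)) k)) nil_nform).
  case: k k0 {gk} => // k _; elim: k => [|k IH].
    by rewrite [gpow _ _]gmulg1; apply: step.
  rewrite -[gpow _ _]/(aeval (u :: p) ** gpow (aeval (u :: p)) k.+1) fM sapplyM.
  apply: step; apply: starts_nf.
  suff -> : ~~ tag (last u p) = tag u by [].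
  by move: lu; do 2!case: (tag _).
by rewrite gk hom1.
Qed.

Lemma al_in_base s s' (g : A s) : in_base g -> exists h : A s', al g = al h.
Proof.
by case=> c ->; exists (i s' c); case: s s' {g} => -[]; rewrite ?al_base.
Qed.

(** Either both letters lie in one factor, or the first lies in the base and can be rewritten in the
    factor of the second. *)
Lemma merge_letters u v : ~~ reduced_step u v ->
  exists w, aeval [:: u; v] = aeval [:: w].
Proof.
rewrite negb_and negbK => /orP[/eqP|/asboolPn/contrapT uC].
  case: u v => s g [s' h] /= ss'; case: _ / ss' h => h.
  by exists (existT _ s (g ** h)); rewrite /= alM !gmulg1.
have [h uh] := al_in_base (tag v) uC.
by exists (existT _ (tag v) (h ** tagged v)); rewrite /= alM !gmulg1 uh.
Qed.

Lemma conj_aeval_rot v w : gconj (aeval (v ++ w)) (aeval v) = aeval (w ++ v).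
Proof. by rewrite /gconj !aeval_cat gmulA gmulKl. Qed.

(** Induction on the length of a word for [g]. From length two on, a cyclically reduced word has
    infinite order; any other can be rotated, which conjugates [g], until its first two letters
    merge. *)
Theorem amalgam_torsion g k : 0 < k -> gpow g k = gone ->
  exists s (a : A s) h, g = gconj (al a) h /\ gpow a k = gone.
Proof.
move=> k0 gk.
(* The order of [a] is controlled by that of [g], since [al] is injective and conjugation commutes
   with powers. *)
suff conjP : exists s (a : A s) h, g = gconj (al a) h.
  have [s [a [h E]]] := conjP; exists s, a, h; split=> //.
  apply: (@amalgam_inj s); rewrite hom_pow // al1.
  move: gk; rewrite E gconj_pow => /(congr1 (fun z => gconj z (ginv h))).
  by rewrite gconjJ gmulgV gconjg1 gconj1.
have [w gw] := aeval_surj g.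
have [m sz] : exists m, size w <= m by exists (size w).
elim: m g w sz gk gw => [|m IH] g w sz gk gw.
  case: w sz gw => //= _ ->; exists true, gone, gone.
  by rewrite al1 gconj1.
case: w sz gw => [|u [|v l]] sz gw.
- by exists true, gone, gone; rewrite al1 gconj1 gw.
- by exists (tag u), (tagged u), gone; rewrite gconjg1 gw /= gmulg1.
have [/cycle_pow_neq1/(_ k0)|nc] := boolP (cycle reduced_step [:: u, v & l]).
  by rewrite -gw.
have [p [q [a [b [r [pq qp nab]]]]]] := not_cycle_split nc.
have [c abc] := merge_letters nab.
have gE : gconj g (aeval p) = aeval (c :: r).
  rewrite gw -pq conj_aeval_rot qp -[c :: r]/([:: c] ++ r) aeval_cat -abc.
  by rewrite -aeval_cat.
have [||s [x [h E]]] := IH (gconj g (aeval p)) _ _ _ gE.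
- have: size (q ++ p) = size [:: u, v & l] by rewrite -pq !size_cat addnC.
  by rewrite qp /= => -[->].
- by rewrite gconj_pow gk gconj1.
- exists s, x, (h ** ginv (aeval p)); rewrite -gconjJ -E gconjJ gmulgV.
  by rewrite gconjg1.
Qed.

End Amalgam.

(** * Cyclic groups *)

Definition zmod_grp (V : zmodType) : Grp :=
  @Build_Grp V _ _ _ (@GRing.addrA V) (@GRing.add0r V) (@GRing.addNr V).

Definition triv_grp : Grp.
Proof. by apply: (@Build_Grp unit (fun _ _ => tt) (fun _ => tt) tt) => // -[]. Defined.

Definition Zgrp : Grp := zmod_grp int.

Definition zpow (G : Grp) (g : G) (z : Zgrp) : G :=
  match z with Posz n => gpow g n | Negz n => gpow (ginv g) n.+1 end.

Section Zpow.
Variable G : Grp.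
Implicit Types (g : G) (z : Zgrp).

Lemma zpow_succ g (z : int) : zpow g (z + 1)%R = zpow g z ** g.
Proof.
case: z => [n|[|n]].
- by rewrite -[(_ + _)%R]/(Posz (n + 1)) addn1; apply: gpowSr.
- by rewrite /= gmulg1 gmulV.
- have -> : (Negz n.+1 + 1)%R = Negz n.
    by rewrite !NegzE -[n.+2]addn1 PoszD GRing.opprD GRing.subrK.
  rewrite -[LHS]/(gpow (ginv g) n.+1) -[RHS]/(gpow (ginv g) n.+2 ** g).
  by rewrite (gpowSr _ n.+1) -gmulA gmulV gmulg1.
Qed.

Lemma zpow_hom g : is_hom (zpow g).
Proof.
move=> a; elim/int_rect=> [|n IH|n IH].
- by rewrite -[a ** _]/(a + 0)%R GRing.addr0 gmulg1.
- by rewrite -[a ** _]/(a + n.+1%:Z)%R -addn1 PoszD GRing.addrA !zpow_succ IH gmulA.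
- apply: (@gmul_injr _ g); rewrite -gmulA -!zpow_succ -[a ** _]/(a + _)%R.
  by rewrite -GRing.addrA -addn1 PoszD GRing.opprD -!GRing.addrA GRing.addNr GRing.addr0 -IH.
Qed.

Lemma zpow1 g : zpow g (1 : int)%R = g.
Proof. exact: gmulg1. Qed.

Lemma zhom_zpow (h : Zgrp -> G) : is_hom h -> forall z, h z = zpow (h (1 : int)%R) z.
Proof.
move=> hM; elim/int_rect=> [|n IH|n IH].
- exact: hom1 hM.
- by rewrite -addn1 PoszD zpow_succ -IH -hM.
- apply: (@gmul_injr _ (h (1 : int)%R)); rewrite -zpow_succ -hM.
  rewrite -[_ ** _]/(_ + _)%R -addn1 PoszD GRing.opprD.
  by rewrite -!GRing.addrA GRing.addNr GRing.addr0 -IH.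
Qed.

Lemma zpow_inj g : (forall k, 0 < k -> gpow g k <> gone) -> injective (zpow g).
Proof.
move=> inf; apply: hom_inj; first exact: zpow_hom.
case=> [[|n]|n] //; first by move/inf => /(_ isT).
rewrite -[Negz n]/(ginv (Posz n.+1 : Zgrp)) homV; last exact: zpow_hom.
move=> E; suff /inf : gpow g n.+1 = gone by move/(_ isT).
by rewrite -[LHS]/(zpow g n.+1) -[LHS]ginvK E ginv1.
Qed.

End Zpow.

Lemma Zgrp_pow (z : Zgrp) k : gpow z k = ((z : int) *+ k)%R.
Proof. by elim: k => [|k IH] //; rewrite GRing.mulrS -IH. Qed.

Lemma Zgrp_torsion_free (z : Zgrp) k : 0 < k -> gpow z k = gone -> z = gone.
Proof.
rewrite Zgrp_pow; case: k => // k _ /eqP.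
by rewrite -[gone]/(0 : int)%R -GRing.mulr_natr GRing.mulf_eq0 natz orbF => /eqP.
Qed.

(** * Presentations *)

(** Assignments are total on strings, but [presents] constrains homomorphisms only on the listed
    generators; under [wf], values elsewhere cannot affect the relators. *)
Definition wf (P : presentation) : Prop :=
  forall r, r \in prels P -> forall l, l \in r -> l.1 \in pgens P.

Section EvalWord.
Variable G : Grp.
Implicit Types x y : seq bool -> G.

Lemma eval_word_cat x v w : eval_word x (v ++ w) = eval_word x v ** eval_word x w.
Proof. by elim: v => [|l v IH] /=; rewrite ?gmul1 // IH gmulA. Qed.

Definition inv_word (w : seq (seq bool * bool)) := rev [seq (l.1, ~~ l.2) | l <- w].

Lemma eval_word_inv x w : eval_word x (inv_word w) = ginv (eval_word x w).
Proof.
elim: w => [|[s b] w IH] /=; first by rewrite ginv1.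
rewrite /inv_word /= rev_cons -cats1 eval_word_cat ginvM -IH /= gmulg1.
by case: b; rewrite /eval_letter /= ?ginvK.
Qed.

Lemma eq_eval_word x y w : (forall l, l \in w -> x l.1 = y l.1) ->
  eval_word x w = eval_word y w.
Proof.
elim: w => //= l w IH xy; rewrite IH => [|l' lw].
  by rewrite /eval_letter (xy l) ?mem_head.
by rewrite xy // inE lw orbT.
Qed.

Lemma satisfies_eq P x y : wf P -> {in pgens P, x =1 y} ->
  satisfies P x -> satisfies P y.
Proof.
move=> wfP xy Px r rP; rewrite -(Px r rP).
by apply/esym/eq_eval_word => l /(wfP r rP)/xy.
Qed.

End EvalWord.

Lemma satisfies_hom (G H : Grp) (f : G -> H) P x :
  is_hom f -> satisfies P x -> satisfies P (f \o x).
Proof. by move=> fM Px r /Px; rewrite -hom_eval_word // => ->; apply: hom1. Qed.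

Lemma presents_ext (G H : Grp) P (x : seq bool -> G) (f f' : G -> H) :
  presents P x -> is_hom f -> is_hom f' ->
  (forall s, s \in pgens P -> f (x s) = f' (x s)) -> f =1 f'.
Proof.
move=> [Px univ] fM f'M ff'.
have [_] := univ H (f' \o x) (satisfies_hom f'M Px); exact.
Qed.

(** The relators hold in the subgroup [S], so [G] maps into it; followed by the inclusion, this map
    fixes the generators and is therefore the identity. *)
Lemma presents_gen (G : Grp) P (x : seq bool -> G) (S : G -> Prop) :
  wf P -> presents P x -> is_subgroup S -> (forall s, s \in pgens P -> S (x s)) ->
  forall g, S g.
Proof.
move=> wfP Px subS Sx g.
have [K [v [vM vI vS Sv]]] := subgroup_grp subS.
have S1 : S gone by case: subS.
(* Off the generators [x s] need not lie in [S], hence the default [gone]. *)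
have Sx' s : exists k, v k = if s \in pgens P then x s else gone.
  by apply: Sv; case: ifP => // /Sx.
have [y yE] := choice Sx'.
have Py : satisfies P y.
  move=> r rP; apply: vI; rewrite hom_eval_word // hom1 //; move: r rP.
  by apply: (satisfies_eq wfP _ Px.1) => s sP; rewrite /= yE sP.
have [[f [fM fx]] _] := Px.2 K y Py.
suff <- : v (f g) = g by [].
have vfM : is_hom (v \o f) by move=> a b; rewrite /= fM vM.
apply: (presents_ext (f := v \o f) (f' := id) Px) => // s sP.
by rewrite /= fx // yE sP.
Qed.

Lemma presented_exists P : wf P ->
  exists (G : Grp) (x : seq bool -> G), presents P x.
Proof.
move=> wfP.
(* Words are identified when all groups satisfying the relators evaluate them equally. Letters that
   are not generators evaluate to [gone], so they die in the quotient and do not spoil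
   uniqueness. *)
pose R v w := forall (K : Grp) (e : seq bool -> K), satisfies P e ->
  (forall s, s \notin pgens P -> e s = gone) -> eval_word e v = eval_word e w.
have [| | | | | | | |Q [pi [piM piS piP]]] :=
  @quotient_grp (seq (seq bool * bool)) cat inv_word [::] R; rewrite /R.
- by [].
- by move=> v w vw K e Pe e1; rewrite vw.
- by move=> v u w uv vw K e Pe e1; rewrite uv // vw.
- by move=> v v' w w' vv' ww' K e Pe e1; rewrite !eval_word_cat vv' // ww'.
- by move=> v v' vv' K e Pe e1; rewrite !eval_word_inv vv'.
- by move=> u v w K e Pe e1; rewrite catA.
- by [].
- by move=> w K e Pe e1; rewrite eval_word_cat eval_word_inv gmulV.
pose x s := pi [:: gen s].
have pi1 : pi [::] = gone by apply: (@gmul_injl _ (pi [::])); rewrite -piM gmulg1.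
have piE w : eval_word x w = pi w.
  elim: w => [|[s b] w IH] //=; rewrite IH -cat1s piM; congr (_ ** _).
  rewrite /eval_letter; case: b => //=; apply: ginv_eq; rewrite /x -piM -pi1.
  by apply/piP => K e _ _; rewrite /= /eval_letter /= gmulg1 gmulgV.
have Px : satisfies P x.
  by move=> r rP; rewrite piE -pi1; apply/piP => K e Pe _; apply: Pe.
exists Q, x; split=> // H y Py; split=> [|f f' fM f'M fx f'x g].
  pose y' s := if s \in pgens P then y s else gone.
  have Py' : satisfies P y'.
    by apply: satisfies_eq Py => // s sP; rewrite /y' sP.
  have y'1 s : s \notin pgens P -> y' s = gone by rewrite /y' => /negbTE ->.
  have [rep repK] := choice piS.
  have repE w : eval_word y' (rep (pi w)) = eval_word y' w.
    by have /piP := repK (pi w); apply.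
  exists (fun q => eval_word y' (rep q)); split=> [a b|s sP].
    by rewrite -(repK a) -(repK b) -piM !repE eval_word_cat.
  by rewrite repE /= gmulg1 /eval_letter /= /y' sP.
have [w <-] := piS g; rewrite -piE !hom_eval_word //; apply: eq_eval_word => -[s b] _ /=.
have [sP|nsP] := boolP (s \in pgens P); first by rewrite fx ?f'x.
suff -> : x s = gone by rewrite !hom1.
rewrite -pi1; apply/piP => K e _ e1.
by rewrite /= /eval_letter /= e1 // gmulg1.
Qed.

(** * The presentations [P_n] *)

Lemma mem_strings n s : (s \in strings n) = (size s == n).
Proof.
elim: n s => [|n IH] s /=; first by rewrite inE size_eq0.
apply/flatten_mapP/eqP => [[t]|].
  by rewrite IH !inE => /eqP <- /orP[]/eqP ->; rewrite size_rcons.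
case/lastP: s => // s b; rewrite size_rcons => -[sn].
by exists s; rewrite ?IH ?sn // !inE; case: b; rewrite eqxx ?orbT.
Qed.

Lemma mem_strings_lt n s : (s \in strings_lt n) = (size s < n).
Proof.
apply/flatten_mapP/idP => [[i]|sn].
  by rewrite mem_iota mem_strings => /andP[_ ilt] /eqP ->.
by exists (size s); rewrite ?mem_iota ?mem_strings.
Qed.

Lemma mem_pgens n s : (s \in pgens (Pres n)) = (size s < n).
Proof. by case: n => // n; apply: mem_strings_lt. Qed.

Lemma size_strings n : size (strings n) = 2 ^ n.
Proof.
elim: n => //= n IH; rewrite size_flatten /shape -map_comp sumnE big_map /=.
by rewrite big_const_seq count_predT IH iter_addn_0 expnS.
Qed.

Lemma size_strings_lt n : size (strings_lt n) = 2 ^ n - 1.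
Proof.
elim: n => // n IH; rewrite /strings_lt -addn1 iotaD map_cat flatten_cat size_cat.
rewrite [size _]IH /= cats0 size_strings addn1 expnS mul2n -addnn.
by rewrite addnC addnBA // expn_gt0.
Qed.

Lemma uniq_strings n : uniq (strings n).
Proof.
elim: n => //= n; elim: (strings n) => //= s l IH /andP[sl ul].
have notin b : rcons s b \notin flatten [seq [:: rcons t false; rcons t true] | t <- l].
  apply: contra sl => /flatten_mapP[t tl]; rewrite !inE.
  by case/orP=> /eqP/rcons_inj[->].
rewrite IH // andbT inE negb_or notin notin !andbT.
by apply/eqP => /rcons_inj[].
Qed.

Lemma uniq_strings_lt n : uniq (strings_lt n).
Proof.
elim: n => // n IH; rewrite /strings_lt -addn1 iotaD map_cat flatten_cat cat_uniq.
rewrite IH /= cats0 uniq_strings andbT; apply/hasPn => s.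
rewrite add0n mem_strings => /eqP sn.
by rewrite -[flatten _]/(strings_lt n) mem_strings_lt sn ltnn.
Qed.

Lemma satisfies_Pres n (G : Grp) (x : seq bool -> G) :
  satisfies (Pres n.+1) x <->
  (forall s, size s = n -> gpow (x s) 3 = gone) /\
  (forall s, size s < n ->
     x (rcons s false) ** x (rcons s true) = gpow (x s) 3).
Proof.
have splitE s : eval_word x (rel_split s) =
    x (rcons s false) ** x (rcons s true) ** ginv (gpow (x s) 3).
  by rewrite /= /eval_letter /= !ginvM ginv1 gmul1 !gmulA gmulg1.
split=> [Px|[Pc Ps] r].
  split=> s sn.
    apply: (Px (rel_cube s)); rewrite mem_cat map_f ?orbT //.
    by rewrite mem_strings sn.
  apply: gmulV_eq1; rewrite -splitE; apply: Px.
  by rewrite mem_cat map_f ?orbT // mem_strings_lt.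
rewrite mem_cat => /orP[]/mapP[s].
  by rewrite mem_strings => /eqP sn ->; apply: Pc.
by rewrite mem_strings_lt => sn ->; rewrite splitE Ps // gmulgV.
Qed.

Lemma wf_Pres n : wf (Pres n).
Proof.
case: n => // n r rP l lr; rewrite mem_pgens; move: rP lr.
rewrite mem_cat => /orP[]/mapP[s].
  by rewrite mem_strings => /eqP <- ->; rewrite !inE => /or3P[]/eqP ->.
rewrite mem_strings_lt => sn ->; rewrite !inE.
by do 4?case/orP; move=> /eqP -> /=; rewrite ?size_rcons // ltnS // ltnW.
Qed.

Lemma root_neq1 n (G : Grp) (x : seq bool -> G) :
  presents (Pres n.+1) x -> x [::] <> gone.
Proof.
move=> [_ univ] x1.
(* Cubes vanish in Z/3, so the relator at the root holds whether or not the root is a leaf. *)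
pose y (s : seq bool) : zmod_grp 'Z_3 := if s is [::] then 1%R else 0%R.
have Py : satisfies (Pres n.+1) y.
  by apply/satisfies_Pres; split=> -[|b s] _; apply: val_inj.
have [[f [fM fx]] _] := univ _ y Py.
by have := fx [::]; rewrite mem_pgens x1 hom1 // => /(_ isT)/(congr1 val).
Qed.

(** * Torsion in [P_n] *)

Definition shift_word (s : bool) (w : seq (seq bool * bool)) :=
  [seq (s :: l.1, l.2) | l <- w].

(** The free product of two copies. With the copy recorded as first letter, the generators of
    [free_square (Pres n.+1)] are the non-root generators of [Pres n.+2]; children are formed at the
    other end of the string, so the relators match too. *)
Definition free_square (P : presentation) : presentation :=
  {| pgens := [seq false :: t | t <- pgens P] ++ [seq true :: t | t <- pgens P];
     prels := map (shift_word false) (prels P) ++ map (shift_word true) (prels P) |}.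

Lemma eval_shift (G : Grp) (x : seq bool -> G) s w :
  eval_word x (shift_word s w) = eval_word (x \o cons s) w.
Proof. by elim: w => //= l w ->. Qed.

Lemma satisfies_free_square P (G : Grp) (x : seq bool -> G) :
  satisfies (free_square P) x <-> forall s, satisfies P (x \o cons s).
Proof.
split=> [Px s r rP|Px r].
  rewrite -eval_shift; apply: Px; rewrite mem_cat.
  by case: s; rewrite map_f ?orbT.
by rewrite mem_cat => /orP[]/mapP[r' rP ->]; rewrite eval_shift; apply: Px.
Qed.

Lemma mem_free_square P t : (t \in pgens (free_square P)) =
  if t is _ :: t' then t' \in pgens P else false.
Proof.
rewrite mem_cat; case: t => [|s t].
  by apply/norP; split; apply/mapP => -[].
have consE b : (s :: t \in [seq b :: t' | t' <- pgens P]) = (s == b) && (t \in pgens P).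
  apply/mapP/andP => [[t' tP [-> ->]] // | [/eqP <- tP]].
  by exists t.
by rewrite !consE; case: (s); rewrite ?orbF.
Qed.

Lemma wf_free_square P : wf P -> wf (free_square P).
Proof.
move=> wfP r; rewrite mem_cat => /orP[]/mapP[r' rP ->] l /mapP[l' lr ->];
by rewrite mem_free_square; apply: wfP rP _ lr.
Qed.

Section FreeSquare.
Variables (P : presentation) (A F : Grp) (a : seq bool -> A) (f : seq bool -> F).
Hypotheses (wfP : wf P) (aP : presents P a) (fP : presents (free_square P) f).

(** These are the conditions on [al] for an amalgam of two copies of [A] over the trivial group. *)
Lemma free_square_amalgam : exists al : bool -> A -> F,
  [/\ forall s, is_hom (al s),
      forall s t, t \in pgens P -> al s (a t) = f (s :: t),
      forall S : F -> Prop,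
        is_subgroup S -> (forall s g, S (al s g)) -> forall g, S g
    & forall (K : Grp) (be : bool -> A -> K), (forall s, is_hom (be s)) ->
        exists h : F -> K, is_hom h /\ forall s g, h (al s g) = be s g].
Proof.
have/satisfies_free_square fs := fP.1.
have ex s : exists h : A -> F,
    is_hom h /\ forall t, t \in pgens P -> h (a t) = f (s :: t).
  by have [[h hP] _] := aP.2 F (f \o cons s) (fs s); exists h.
have [al alP] := choice ex; exists al.
have alM s : is_hom (al s) by case: (alP s).
have ala s t : t \in pgens P -> al s (a t) = f (s :: t) by case: (alP s) => _; apply.
split=> // [S subS Sal|K be beM].
  apply: (presents_gen (wf_free_square wfP) fP subS) => t.
  by rewrite mem_free_square; case: t => // s t /ala <-.
pose y t := if t is s :: t' then be s (a t') else gone.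
have Py : satisfies (free_square P) y.
  apply/satisfies_free_square => s; exact: satisfies_hom (beM s) aP.1.
have [[h [hM hf]] _] := fP.2 K y Py; exists h; split=> // s.
apply: (presents_ext (f := h \o al s) aP) => // [b c|t tP] /=.
  by rewrite alM hM.
by rewrite ala // hf ?mem_free_square.
Qed.

Lemma free_square_torsion g k : 0 < k -> gpow g k = gone ->
  exists (al : A -> F) b h s, [/\ is_hom al,
    forall t, t \in pgens P -> al (a t) = f (s :: t),
    g = gconj (al b) h & gpow b k = gone].
Proof.
have [al [alM ala al_gen al_univ]] := free_square_amalgam => k0 gk.
pose i (s : bool) (c : triv_grp) : A := gone.
have iM s : is_hom (i s) by move=> c d; rewrite gmul1.
have iI s : injective (i s) by move=> [] [].
have [||||s [b [h [gE bk]]]] :=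
  @amalgam_torsion triv_grp (fun=> A) i iM iI F al _ _ _ _ g k k0 gk => //.
- by move=> c; rewrite !hom1.
- by move=> K be beM _; apply: al_univ.
by exists (al s), b, h, s; split=> //; apply: ala.
Qed.

(** The two letters lie in different factors and outside the trivial base, so the word is cyclically
    reduced. *)
Lemma free_square_infinite t k : t \in pgens P -> a t <> gone -> 0 < k ->
  gpow (f [:: false & t] ** f [:: true & t]) k <> gone.
Proof.
have [al [alM ala al_gen al_univ]] := free_square_amalgam => tP at1 k0.
pose i (s : bool) (c : triv_grp) : A := gone.
have iM s : is_hom (i s) by move=> c d; rewrite gmul1.
have iI s : injective (i s) by move=> [] [].
rewrite -!ala // -(gmulg1 (al true _)).
apply: (@cycle_pow_neq1 triv_grp (fun=> A) i iM iI F al _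
  (existT _ false (a t)) [:: existT _ true (a t)]) => //.
  by move=> K be beM _; apply: al_univ.
by rewrite /= /reduced_step /= andbT; apply/andP; split; apply/asboolP => -[].
Qed.

End FreeSquare.

Definition leaf n (G : Grp) (x : seq bool -> G) (g : G) :=
  exists2 s, size s = n & g = x s.

(* Adjoining a cube root of an element [c] of infinite order to [F] means
   amalgamating [F] with the integers along [c = 3]. *)
Lemma root_adjunction_torsion n (F G : Grp) (f : seq bool -> F) (x : seq bool -> G)
    (phi : F -> G) :
  presents (free_square (Pres n.+1)) f -> presents (Pres n.+2) x ->
  is_hom phi -> (forall s t, size t < n.+1 -> phi (f (s :: t)) = x (s :: t)) ->
  (forall k, 0 < k -> gpow (f [:: false] ** f [:: true]) k <> gone) ->
  forall g k, 0 < k -> gpow g k = gone ->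
  exists b h, g = gconj (phi b) h /\ gpow b k = gone.
Proof.
move=> fP xP phiM phif inf g k k0 gk.
have /satisfies_Pres[xc xs] := xP.1.
have /satisfies_free_square fs := fP.1.
pose A (s : bool) := if s then Zgrp else F.
pose c := f [:: false] ** f [:: true].
(* The generator of the common subgroup Z goes to [c] in [F] and to 3 in Z. *)
pose i (s : bool) : Zgrp -> A s :=
  if s return Zgrp -> A s then fun z => (z : int) *+ 3 : int else zpow c.
pose al (s : bool) : A s -> G :=
  if s return A s -> G then zpow (x [::]) else phi.
have mul3M : is_hom (i true) by move=> a b; apply: GRing.mulrnDl.
have iM s : is_hom (i s) by case: s => //; apply: zpow_hom.
have iI s : injective (i s).
  case: s; last exact: zpow_inj.
  apply: hom_inj => // z; rewrite -[i _ z]/((z : int) *+ 3)%R -Zgrp_pow.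
  exact: Zgrp_torsion_free.
have alM s : is_hom (al s) by case: s => //; apply: zpow_hom.
have comp_hom (K L M : Grp) (u : K -> L) (v : L -> M) :
  is_hom u -> is_hom v -> is_hom (v \o u) by move=> uM vM a b; rewrite /= uM vM.
have al_base z : al false (i false z) = al true (i true z).
  (* Homomorphisms from Z are compared at 1, where the equality is the relator at the root. *)
  rewrite -[LHS]/((al false \o i false) z) -[RHS]/((al true \o i true) z).
  rewrite (zhom_zpow (comp_hom _ _ _ _ _ (iM false) (alM false))).
  rewrite (zhom_zpow (comp_hom _ _ _ _ _ (iM true) (alM true))).
  by congr zpow; rewrite /= gmulg1 phiM !phif // (xs [::]).
have al_gen (S : G -> Prop) : is_subgroup S -> (forall s (a : A s), S (al s a)) -> forall g, S g.
  move=> subS Sal; apply: (presents_gen (@wf_Pres n.+2) xP subS) => -[|s t].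
    by have := Sal true (1 : int)%R; rewrite /= gmulg1.
  by rewrite mem_pgens => tn; rewrite -phif //; apply: (Sal false).
have al_univ (K : Grp) (be : forall s, A s -> K) :
  (forall s, is_hom (be s)) -> (forall z, be false (i false z) = be true (i true z)) ->
  exists h : G -> K, is_hom h /\ forall s a, h (al s a) = be s a.
  move=> beM be_base.
  have be0M : is_hom (be false : F -> K) := beM false.
  have be1M : is_hom (be true : Zgrp -> K) := beM true.
  pose y t := if t is [::] then be true (1 : int)%R else be false (f t).
  have Py : satisfies (Pres n.+2) y.
    have fsP s := (satisfies_Pres n (f \o cons s)).1 (fs s).
    apply/satisfies_Pres; split=> -[|s t] //=.
    - case=> /(fsP s).1 ft; rewrite -[LHS](hom_pow be0M (f (s :: t)) 3) ft.
      exact: hom1 be0M.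
    - move=> _; rewrite -be0M -[_ ** _](zpow1 c) -[zpow c _]/(i false (1 : int)%R).
      by rewrite be_base -[RHS](hom_pow be1M (1 : int)%R 3).
    - rewrite ltnS => /(fsP s).2 ft.
      by rewrite -be0M [X in be _ X]ft -[RHS](hom_pow be0M (f (s :: t)) 3).
  have [[h [hM hx]] _] := xP.2 K y Py; exists h; split=> // -[] a.
    rewrite -[LHS]/((h \o al true) a) (zhom_zpow (comp_hom _ _ _ _ _ (alM true) hM)).
    by rewrite [RHS](zhom_zpow be1M) /= gmulg1 hx ?mem_pgens.
  apply: (presents_ext (f := h \o phi) fP) => // [|t]; first exact: comp_hom.
  rewrite mem_free_square; case: t => // s t; rewrite mem_pgens => tn.
  by rewrite /= phif // hx ?mem_pgens.
have [[] [b [h [gE bk]]]] := amalgam_torsion iM iI alM al_base al_gen al_univ k0 gk.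
  (* The factor Z is torsion-free, so here [g] is trivial. *)
  exists gone, gone; rewrite gE (Zgrp_torsion_free k0 bk) gpow1n.
  by rewrite (hom1 (alM true)) (hom1 phiM) !gconj1.
by exists b, h.
Qed.

Lemma torsion_in_leaves n : forall (G : Grp) (x : seq bool -> G),
  presents (Pres n.+1) x -> forall g k, 0 < k -> gpow g k = gone ->
  ncl (leaf n x) g.
Proof.
elim: n => [|n IH] G x xP g k k0 gk.
  (* The only generator of [Pres 1] is a leaf, so the closure is the whole group. *)
  have [N1 NM NV _] := normal_ncl (leaf 0 x).
  apply: (presents_gen (@wf_Pres 1) xP) => [//|s].
  rewrite mem_pgens ltnS leqn0 => /eqP s0.
  by apply: sub_ncl; exists s.
have [A [a aP]] := presented_exists (@wf_Pres n.+1).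
have [F [f fP]] := presented_exists (wf_free_square (@wf_Pres n.+1)).
have /satisfies_Pres[xc xs] := xP.1.
have xF : satisfies (free_square (Pres n.+1)) x.
  apply/satisfies_free_square => s; apply/satisfies_Pres; split=> t tn /=.
    by apply: xc; rewrite /= tn.
  exact: (xs (s :: t)).
have [[phi [phiM phif]] _] := fP.2 G x xF.
(* The element is conjugated first into the free product, then into one of its two copies, where the
   induction hypothesis applies. *)
have [|k' k'0|b [h [-> bk]]] := root_adjunction_torsion fP xP phiM _ _ k0 gk.
- by move=> s t tn; rewrite phif // mem_free_square mem_pgens.
- by apply: (free_square_infinite (@wf_Pres _) aP fP) k'0; [rewrite mem_pgens | apply: root_neq1 aP].
have [al [b' [h' [s [alM ala -> b'k]]]]] :=
  free_square_torsion (@wf_Pres _) aP fP k0 bk.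
have [_ _ _ NJ] := normal_ncl (leaf n.+1 x).
rewrite hom_conj //; do 2!apply: (NJ).
apply: (ncl_hom (f := phi \o al) _ _ (IH A a aP b' k k0 b'k)).
  by move=> c d; rewrite /= alM phiM.
move=> _ [t tn ->]; exists (s :: t); first by rewrite /= tn.
rewrite /= ala ?mem_pgens ?tn // phif // mem_free_square mem_pgens tn //.
Qed.

(** * The torsion series of [P_n] *)

Lemma Tor1_leaves n (G : Grp) (x : seq bool -> G) : presents (Pres n.+1) x ->
  forall g, Tor 1 g <-> ncl (leaf n x) g.
Proof.
move=> xP g; split; apply: ncl_min => {}g.
  by case=> k [k0 gk]; apply: torsion_in_leaves xP _ k k0 gk.
have /satisfies_Pres[xc _] := xP.1.
by case=> s sn ->; apply: sub_ncl; exists 3; split=> //; apply: xc.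
Qed.

Lemma kill_leaves n (G H : Grp) (x : seq bool -> G) (y : seq bool -> H) :
  presents (Pres n.+1) x -> presents (Pres n) y ->
  exists f : G -> H, [/\ is_hom f, forall h, exists g, f g = h,
    forall g, f g = gone <-> Tor 1 g & forall s, size s < n -> f (x s) = y s].
Proof.
(* The map [f] is induced by [y'], which sends the leaves to [gone]. *)
move=> xP yP; have /satisfies_Pres[xc xs] := xP.1.
pose y' s := if size s < n then y s else gone.
have y'P : satisfies (Pres n.+1) y'.
  apply/satisfies_Pres; split=> s sn; rewrite /y'.
    by rewrite sn ltnn gpow1n.
  rewrite !size_rcons sn; case: n sn xP yP xc xs y' => // n sn xP yP xc xs y'.
  have /satisfies_Pres[yc ys] := yP.1.
  (* If the children of [s] are killed leaves, then [s] is a leaf of the smaller presentation and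
     its cube is trivial there. *)
  rewrite ltnS; case: ltnP => [/ys //|ns]; rewrite gmul1 yc //.
  by apply/eqP; rewrite eqn_leq ns -ltnS sn.
have [[f [fM fx]] _] := xP.2 H y' y'P.
have fxy s : size s < n -> f (x s) = y s.
  by move=> sn; rewrite fx ?mem_pgens ?ltnS 1?ltnW // /y' sn.
exists f; split=> //.
  apply: (presents_gen (@wf_Pres n) yP) => [|s].
    split=> [|_ _ [a <-] [b <-]|_ [a <-]]; first by exists gone; apply: hom1.
      by exists (a ** b).
    by exists (ginv a); apply: homV.
  by rewrite mem_pgens => sn; exists (x s); apply: fxy.
move=> g; rewrite (Tor1_leaves xP); split=> [fg1|]; last first.
  move=> lg; apply: (lg (fun g => f g = gone)).
    exact: normal_preim (normal_one H).
  by move=> _ [s sn ->]; rewrite fx ?mem_pgens ?sn // /y' sn ltnn.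
(* For the kernel, [pi] kills the leaves and so factors as [h \o f] with [h] defined on [H]; thus
   [f g = gone] forces [pi g = gone]. *)
have [Q [pi [piM piS pi1]]] := quotient_normal (normal_ncl (leaf n x)).
have pix : satisfies (Pres n) (pi \o x).
  case: n {y' y'P fx fxy fg1} xP yP xc xs pi1 => // n xP yP xc xs pi1.
  apply/satisfies_Pres; split=> s sn; last first.
    by rewrite -piM xs ?hom_pow // ltnS ltnW.
  rewrite -hom_pow // -xs ?sn // piM.
  have leaf1 b : pi (x (rcons s b)) = gone.
    by apply/pi1; apply: sub_ncl; exists (rcons s b); rewrite ?size_rcons ?sn.
  by rewrite !leaf1 gmul1.
have [[h [hM hy]] _] := yP.2 Q _ pix.
apply/pi1; rewrite -(hom1 hM) -fg1; apply/esym.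
apply: (presents_ext (f := h \o f) xP) => // [a b|s]; first by rewrite /= fM hM.
rewrite mem_pgens ltnS /= leq_eqVlt => /orP[/eqP sn|sn].
  rewrite fx ?mem_pgens ?sn // /y' sn ltnn hom1 //.
  by apply/esym/pi1; apply: sub_ncl; exists s.
by rewrite fxy // hy // mem_pgens.
Qed.

Lemma Tor_one (G : Grp) i : Tor i (gone : G).
Proof. by case: i => // i N [N1 _ _ _]. Qed.

(** The kernel gives the case [i = 0]. Afterwards [f] matches the generating sets, as it preserves
    powers, and normal closure commutes with preimage by [ncl_preim]. *)
Lemma Tor_preim (G H : Grp) (f : G -> H) : is_hom f ->
  (forall h, exists g, f g = h) -> (forall g, f g = gone <-> Tor 1 g) ->
  forall i g, Tor i.+1 g <-> Tor i (f g).
Proof.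
move=> fM surj ker; elim=> [|i IH] g; first by rewrite -ker.
rewrite -[Tor i.+2]/(ncl _) -[Tor i.+1]/(ncl _); split.
  apply: ncl_hom => // a [k [k0 ak]]; exists k; split=> //.
  by rewrite -hom_pow //; apply/IH.
move=> nfg; have T1 : exists k, 0 < k /\ Tor i (gpow (gone : H) k).
  by exists 1; rewrite gpow1n; split=> //; apply: Tor_one.
apply: ncl_min (ncl_preim fM surj T1 nfg) => a [k [k0 ak]].
by apply: sub_ncl; exists k; split=> //; apply/IH; rewrite hom_pow.
Qed.

Lemma Tor_Pres n : forall (G : Grp) (x : seq bool -> G),
  presents (Pres n) x -> forall g : G, Tor n g.
Proof.
elim: n => [|n IH] G x xP g.
  by apply: (presents_gen (@wf_Pres 0) xP (S := fun g => g = gone)) => //;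
     case: (normal_one G).
have [H [y yP]] := presented_exists (@wf_Pres n).
have [f [fM surj ker _]] := kill_leaves xP yP.
by apply/(Tor_preim fM surj ker)/(IH H y yP).
Qed.

(** Killing the leaves lowers [n] and [k] together and sends root to root, until [k = 0], where
    [root_neq1] applies. *)
Lemma root_notin_Tor n : forall (G : Grp) (x : seq bool -> G),
  presents (Pres n) x -> forall k, k < n -> ~ Tor k (x [::]).
Proof.
elim: n => [|n IH] G x xP [|k] // kn; first exact: root_neq1 xP.
have [H [y yP]] := presented_exists (@wf_Pres n).
have [f [fM surj ker fx]] := kill_leaves xP yP.
move/(Tor_preim fM surj ker); rewrite fx; first exact: IH yP k kn.
exact: leq_ltn_trans (leq0n k) kn.
Qed.

Theorem theorem4p3 (n : nat) (Hn : 0 < n)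
    (G : Grp) (x : seq bool -> G) (HG : presents (Pres n) x)
    (H : Grp) (y : seq bool -> H) (HH : presents (Pres n.-1) y) :
  (* (1) G / Tor_1(G) is isomorphic to H, i.e. there is a surjective
         homomorphism G -> H whose kernel is exactly Tor_1(G) *)
  (exists f : G -> H, [/\ is_hom f, (forall h : H, exists g, f g = h) &
                          (forall g, f g = gone <-> Tor 1 g)]) /\
  (* (2) TorLen(G) = n *)
  TorLen_is G n /\
  (* P_n has 2^n - 1 (distinct) generators and 2^n - 1 relators *)
  (uniq (pgens (Pres n)) /\ size (pgens (Pres n)) = 2 ^ n - 1) /\
  size (prels (Pres n)) = 2 ^ n - 1.
Proof.
split.
  case: n Hn HG HH => // n _ HG HH.
  by have [f [fM surj ker _]] := kill_leaves HG HH; exists f.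
split.
  split=> [g|k kn Tk]; first by split=> [?|_]; [exists n | apply: Tor_Pres HG g].
  (* As [Tor n] is everything, stabilizing at [k] would put the root in [Tor k]. *)
  by apply: (root_notin_Tor HG kn); apply/Tk; exists n; apply: Tor_Pres HG _.
case: n Hn {HG HH} => // n _; split.
  by split; [apply: uniq_strings_lt | apply: size_strings_lt].
(* With [n] now the predecessor, there are [2 ^ n] leaf relators and [2 ^ n - 1] splitting
   relators. *)
rewrite size_cat !size_map size_strings size_strings_lt.
by rewrite addnBA ?expn_gt0 // addnn -mul2n -expnS.
Qed.
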